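(* Let $\rho:\mathrm{U}(1)\to\mathrm{GL}(V)$ be a complex, finite-dimensional, self-dual, faithful representation of $\mathrm{U}(1)$. Then $\rho$ is uniquely determined (up to isomorphism, among all complex, finite-dimensional, self-dual, faithful representations of $\mathrm{U}(1)$) by the function $n\mapsto \dim (V^{\otimes n})^{\mathrm{U}(1)}$ on positive integers. That is, if $\sigma:\mathrm{U}(1)\to\mathrm{GL}(W)$ is another complex, finite-dimensional, self-dual, faithful representation and $\dim (V^{\otimes n})^{\mathrm{U}(1)}=\dim (W^{\otimes n})^{\mathrm{U}(1)}$ for every positive integer $n$, then $V\cong W$ as representations of $\mathrm{U}(1)$.
   Context: $\mathrm{U}(1)$ is the circle group $\{z\in\mathbb{C}:|z|=1\}$. Representations are continuous. $V^{\otimes n}$ carries the diagonal action, and $(\cdot)^{\mathrm{U}(1)}$ denotes the subspace of invariant vectors. A representation is self-dual if it is isomorphic to its dual, and faithful if $\rho$ is injective. *)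

(* Defs.v *)
From HB Require Import structures.
From mathcomp Require Import all_boot all_order all_algebra.
From mathcomp Require Import complex.
From mathcomp Require Import all_classical all_reals all_analysis.

Set Implicit Arguments.
Unset Strict Implicit.
Unset Printing Implicit Defensive.

Import Order.TTheory GRing.Theory Num.Theory.
Import numFieldNormedType.Exports.

Local Open Scope classical_set_scope.
Local Open Scope ring_scope.
Local Open Scope complex_scope.

(* [R[i]^o] is the field [R[i]] of complex numbers seen as a vector space over
   itself; MathComp-Analysis puts its topology on this alias. *)

Section CircleGroup.
Variable R : realType.

Definition circle : set R[i]^o := [set z | `|z| = 1].

Definition U1 : Type := set_type circle.

HB.instance Definition _ := Choice.on U1.
(* The subspace topology induced by the complex numbers. *)
HB.instance Definition _ := Topological.on U1.

Definition U1val (z : U1) : R[i]^o := set_val z.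

Lemma U1val_inj : injective U1val.
Proof. exact: val_inj. Qed.

Lemma U1val_norm (z : U1) : `|U1val z| = 1.
Proof. by have /set_mem := valP z. Qed.

Lemma U1val_neq0 (z : U1) : U1val z != 0.
Proof. by rewrite -normr_eq0 U1val_norm oner_eq0. Qed.

Definition U1mk (z : R[i]^o) (z1 : `|z| = 1) : U1 :=
  SigSub (mem_set (z1 : circle z)).

Definition U1one : U1 := U1mk (normr1 _).

Lemma U1mul_subproof (z w : U1) : `|U1val z * U1val w : R[i]^o| = 1.
Proof. by rewrite normrM !U1val_norm mulr1. Qed.

Definition U1mul (z w : U1) : U1 := U1mk (U1mul_subproof z w).

Lemma U1inv_subproof (z : U1) : `|(U1val z)^-1 : R[i]^o| = 1.
Proof. by rewrite normfV U1val_norm invr1. Qed.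

Definition U1inv (z : U1) : U1 := U1mk (U1inv_subproof z).

Lemma U1mulA : associative U1mul.
Proof. by move=> x y z; apply: U1val_inj; apply: mulrA. Qed.
Lemma U1mul1g : left_id U1one U1mul.
Proof. by move=> x; apply: U1val_inj; apply: mul1r. Qed.
Lemma U1mulg1 : right_id U1one U1mul.
Proof. by move=> x; apply: U1val_inj; apply: mulr1. Qed.
Lemma U1mulVg : left_inverse U1one U1inv U1mul.
Proof. by move=> x; apply: U1val_inj; apply: mulVf; apply: U1val_neq0. Qed.
Lemma U1mulgV : right_inverse U1one U1inv U1mul.
Proof. by move=> x; apply: U1val_inj; apply: mulfV; apply: U1val_neq0. Qed.

HB.instance Definition _ :=
  isGroup.Build U1 U1mulA U1mul1g U1mulg1 U1mulVg U1mulgV.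

Lemma U1val_continuous : continuous U1val.
Proof. exact: initial_continuous. Qed.

Lemma U1inv_continuous : continuous (fun z : U1 => z^-1%g).
Proof.
apply: continuous_comp_initial => z.
exact: (@cvgV R[i]^o _ (nbhs z) _ U1val (U1val z) (U1val_neq0 z)
  (@U1val_continuous z)).
Qed.

End CircleGroup.

Section Continuity.
Variables (K : numFieldType) (T : topologicalType).
Implicit Types (I : Type) (f g : T -> K^o).

Lemma fsum_continuous I (r : seq I) (F : I -> T -> K^o) :
  (forall i, continuous (F i)) -> continuous (fun z => \sum_(i <- r) F i z).
Proof.
move=> Fc; elim: r => [|i r IH] z.
  rewrite (_ : (fun _ => _) = fun=> 0 : K^o); first exact: cvg_cst.
  by apply/funext => w; rewrite big_nil.
rewrite (_ : (fun _ => _) = fun w => F i w + \sum_(j <- r) F j w).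
  by apply: cvgD; [exact: Fc|exact: IH].
by apply/funext => w; rewrite big_cons.
Qed.

Lemma fmul_continuous f g :
  continuous f -> continuous g -> continuous (fun z => f z * g z : K^o).
Proof. by move=> fc gc z; apply: cvgM; [exact: fc|exact: gc]. Qed.

Lemma fprod_continuous I (r : seq I) (F : I -> T -> K^o) :
  (forall i, continuous (F i)) ->
  continuous (fun z => \prod_(i <- r) F i z : K^o).
Proof.
move=> Fc; elim: r => [|i r IH] z.
  rewrite (_ : (fun _ => _) = fun=> 1 : K^o); first exact: cvg_cst.
  by apply/funext => w; rewrite big_nil.
rewrite (_ : (fun _ => _) = fun w => F i w * \prod_(j <- r) F j w : K^o).
  by apply: fmul_continuous; [exact: Fc|exact: IH].
by apply/funext => w; rewrite big_cons.
Qed.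

Lemma fcst_continuous (a : K) : continuous (fun _ : T => a : K^o).
Proof. by move=> z; apply: cvg_cst. Qed.

End Continuity.

Section Representations.
Variable R : realType.
Local Notation C := R[i].
Local Notation U := (U1 R).

(* A homomorphism [U(1) -> GL(V)] is a map to the monoid ['End(V)] preserving
   [1] and products: its values are automatically invertible. The topology on
   the finite-dimensional space ['End(V)] is the one given by the matrix
   coefficients [g |-> phi (g v)]. *)
Record u1rep (V : vectType C) := U1Rep {
  rep_fun :> U -> 'End(V);
  rep1 : rep_fun 1%g = \1%VF;
  repM : forall z w, rep_fun (z * w)%g = (rep_fun z \o rep_fun w)%VF;
  rep_continuous : forall (v : V) (phi : 'Hom(V, C^o)),
    continuous (fun z => phi (rep_fun z v)) }.

Definition rep_iso (V W : vectType C) (rho : u1rep V) (sigma : u1rep W) :=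
  exists f : 'Hom(V, W), bijective f /\
    forall z v, f (rho z v) = sigma z (f v).

Definition faithful (V : vectType C) (rho : u1rep V) := injective rho.

Section Dual.
Variable V : vectType C.

Definition dual_fun (g : 'End(V)) (phi : 'Hom(V, C^o)) : 'Hom(V, C^o) :=
  (phi \o g)%VF.

Lemma dual_fun_is_linear g : linear (dual_fun g).
Proof.
by move=> a p q; rewrite /dual_fun comp_lfunDl -comp_lfunZl.
Qed.

HB.instance Definition _ g :=
  GRing.isLinear.Build C 'Hom(V, C^o) 'Hom(V, C^o) _ (dual_fun g)
    (dual_fun_is_linear g).

Definition dual_map (g : 'End(V)) : 'End('Hom(V, C^o)) := linfun (dual_fun g).

Variable rho : u1rep V.

Definition dual_rep_fun (z : U) : 'End('Hom(V, C^o)) := dual_map (rho z^-1%g).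

Lemma dual_rep1 : dual_rep_fun 1%g = \1%VF.
Proof.
apply/lfunP => p; rewrite lfunE /= id_lfunE /dual_fun monoid.invg1 rep1.
by rewrite comp_lfun1r.
Qed.

Lemma dual_repM z w :
  dual_rep_fun (z * w)%g = (dual_rep_fun z \o dual_rep_fun w)%VF.
Proof.
apply/lfunP => p; rewrite comp_lfunE !lfunE /= /dual_fun monoid.invgM repM.
by rewrite comp_lfunA.
Qed.

Let X := vbasis {:V}.

Lemma dual_rep_continuous (p : 'Hom(V, C^o)) (F : 'Hom('Hom(V, C^o), C^o)) :
  continuous (fun z => F (dual_rep_fun z p)).
Proof.
pose c j : 'Hom(V, C^o) := linfun (coord X j : V -> C^o).
have E z : F (dual_rep_fun z p) =
    \sum_(j < \dim {:V}) p (rho z^-1%g X`_j) * F (c j) :> C^o.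
  have -> : dual_rep_fun z p = \sum_(j < \dim {:V}) (p (rho z^-1%g X`_j) : C) *: c j.
    apply/lfunP => v; rewrite lfunE /= comp_lfunE sum_lfunE.
    rewrite {1}(coord_vbasis (memvf v)) !linear_sum; apply: eq_bigr => j _.
    by rewrite !linearZ /= scale_lfunE lfunE; apply: mulrC.
  by rewrite linear_sum; apply: eq_bigr => j _; rewrite linearZ.
under eq_fun do rewrite E.
apply: fsum_continuous => j; apply: fmul_continuous;
  last exact: fcst_continuous.
move=> z; apply: (@continuous_comp _ _ _ (fun z : U => z^-1%g)
  (fun z => p (rho z X`_j))); first exact: U1inv_continuous.
exact: rep_continuous.
Qed.

Definition dual_rep : u1rep 'Hom(V, C^o) :=
  U1Rep dual_rep1 dual_repM dual_rep_continuous.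

Definition self_dual := rep_iso rho dual_rep.

End Dual.

Section TensorPower.
Variables (V : vectType C) (n : nat).
Local Notation d := (\dim {:V}).
Local Notation X := (vbasis {:V}).

(* The tensor power of [V], in coordinates: [t f] is the coefficient of [t] on
   [e_(f 0) (x) ... (x) e_(f (n-1))], where [e_0, ..., e_(d-1)] is the basis
   [X] of [V]. The lemmas [pure_multilinear] and [pure_basis] say that [pure] is
   multilinear and sends the tuples of basis vectors to a basis, so that
   [tensor] has the universal property of the tensor power; [tensor_map g] is
   the only endomorphism mapping each [pure v] to [pure (g \o v)]. *)
Definition tensor : vectType C := {ffun {ffun 'I_n -> 'I_d} -> C^o}.

(* [v 0 (x) ... (x) v (n-1)] *)
Definition pure (v : 'I_n -> V) : tensor :=
  [ffun f : {ffun 'I_n -> 'I_d} => (\prod_i coord X (f i) (v i) : C^o)].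

Lemma pure_basis (f : {ffun 'I_n -> 'I_d}) :
  pure (fun i => X`_(f i)) = [ffun h => ((h == f)%:R : C^o)].
Proof.
have freeX : free X by apply: basis_free; apply: vbasisP.
apply/ffunP => h; rewrite !ffunE; have [->|hf] := eqVneq h f.
  by rewrite big1 // => i _; rewrite coord_free // eqxx.
have /existsP[i hfi] : [exists i, h i != f i].
  by apply: contra_neqT hf => /existsPn H; apply/ffunP => i; apply/eqP/negPn.
rewrite (bigD1 i) //= coord_free //.
by rewrite eq_sym (negbTE hfi) mul0r.
Qed.

Lemma tensor_basis (t : tensor) :
  t = \sum_(f : {ffun 'I_n -> 'I_d}) (t f : C) *: pure (fun i => X`_(f i)).
Proof.
apply/ffunP => h; rewrite sum_ffunE (bigD1 h) //= big1.
  by rewrite pure_basis !ffunE eqxx addr0; rewrite [RHS]mulr1.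
move=> f fh; rewrite pure_basis !ffunE eq_sym (negbTE fh).
exact: mulr0.
Qed.

Lemma pure_multilinear (v : 'I_n -> V) (i : 'I_n) (a : C) (x y : V) :
  pure (fun j => if j == i then a *: x + y else v j) =
  a *: pure (fun j => if j == i then x else v j) +
  pure (fun j => if j == i then y else v j).
Proof.
apply/ffunP => f; rewrite !ffunE.
have D w : \prod_j coord X (f j) (if j == i then w else v j) =
    coord X (f i) w * \prod_(j | j != i) coord X (f j) (v j).
  rewrite (bigD1 i) //= eqxx; congr (_ * _).
  by apply: eq_bigr => j /negbTE ->.
rewrite !D linearP mulrDl; congr (_ + _).
by rewrite -mulrA.
Qed.

Definition tensor_fun (g : 'End(V)) (t : tensor) : tensor :=
  \sum_(f : {ffun 'I_n -> 'I_d}) (t f : C) *: pure (fun i => g X`_(f i)).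

Lemma tensor_fun_is_linear g : linear (tensor_fun g).
Proof.
move=> a s t; rewrite /tensor_fun scaler_sumr -big_split /=.
by apply: eq_bigr => f _; rewrite !ffunE scalerDl scalerA.
Qed.

HB.instance Definition _ g :=
  GRing.isLinear.Build C tensor tensor _ (tensor_fun g)
    (tensor_fun_is_linear g).

Definition tensor_map (g : 'End(V)) : 'End(tensor) := linfun (tensor_fun g).

Lemma tensor_map_pure g v : tensor_map g (pure v) = pure (fun i => g (v i)).
Proof.
rewrite lfunE /=; apply/ffunP => h; rewrite sum_ffunE ffunE.
transitivity (\sum_(f : {ffun 'I_n -> 'I_d})
    \prod_i (coord X (f i) (v i) * coord X (h i) (g X`_(f i)))).
  by apply: eq_bigr => f _; rewrite !ffunE big_split.
rewrite -(bigA_distr_bigA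
  (fun i j => coord X j (v i) * coord X (h i) (g X`_j))).
apply: eq_bigr => i _; rewrite [in RHS](coord_vbasis (memvf (v i))).
by rewrite !linear_sum; apply: eq_bigr => j _; rewrite !linearZ.
Qed.

Lemma tensor_map_ext (F G : 'End(tensor)) :
  (forall v, F (pure v) = G (pure v)) -> F = G.
Proof.
move=> FG; apply/lfunP => t; rewrite (tensor_basis t) !linear_sum.
by apply: eq_bigr => f _; rewrite !linearZ /= FG.
Qed.

Variable rho : u1rep V.

Lemma tensor_rep1 : tensor_map (rho 1%g) = \1%VF.
Proof.
apply: tensor_map_ext => v; rewrite tensor_map_pure id_lfunE rep1.
by congr pure; apply/funext => i; rewrite id_lfunE.
Qed.

Lemma tensor_repM z w :
  tensor_map (rho (z * w)%g) = (tensor_map (rho z) \o tensor_map (rho w))%VF.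
Proof.
apply: tensor_map_ext => v.
transitivity (tensor_map (rho z) (pure (fun i => rho w (v i)))).
  apply: etrans (tensor_map_pure _ _) _.
  apply: etrans _ (esym (tensor_map_pure _ _)).
  by congr pure; apply/funext => i; rewrite repM comp_lfunE.
rewrite [RHS]comp_lfunE; congr (tensor_map (rho z) _).
exact: esym (tensor_map_pure _ _).
Qed.

Lemma tensor_rep_continuous (t : tensor) (F : 'Hom(tensor, C^o)) :
  continuous (fun z => F (tensor_map (rho z) t)).
Proof.
have E z : F (tensor_map (rho z) t) =
    \sum_(f : {ffun 'I_n -> 'I_d}) (t f : C^o) *
      \sum_(h : {ffun 'I_n -> 'I_d})
        (\prod_i linfun (coord X (h i) : V -> C^o) (rho z X`_(f i))) *
        F (pure (fun i => X`_(h i))) :> C^o.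
  rewrite lfunE /= linear_sum; apply: eq_bigr => f _; rewrite linearZ /=.
  congr (_ * _); rewrite {1}(tensor_basis (pure _)) linear_sum.
  apply: eq_bigr => h _; rewrite linearZ /= ffunE; congr (_ * _).
  by apply: eq_bigr => i _; rewrite lfunE.
under eq_fun do rewrite E.
apply: fsum_continuous => f; apply: fmul_continuous;
  first exact: fcst_continuous.
apply: fsum_continuous => h; apply: fmul_continuous;
  last exact: fcst_continuous.
by apply: fprod_continuous => i; apply: rep_continuous.
Qed.

Definition tensor_rep : u1rep tensor :=
  U1Rep tensor_rep1 tensor_repM tensor_rep_continuous.

End TensorPower.

Section Invariants.
Variables (V : vectType C) (rho : u1rep V).

(* Well defined by [invariantsP]. *)
Definition invariants : {vspace V} :=
  xget 0%VS [set S : {vspace V} | forall v, v \in S <-> forall z, rho z v = v].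

Lemma invariantsP v : v \in invariants <-> forall z, rho z v = v.
Proof.
suff [S SP] : exists S : {vspace V}, forall v, v \in S <-> forall z, rho z v = v.
  rewrite /invariants; exact: (@xgetPex _ 0%VS
    [set S : {vspace V} | forall v, v \in S <-> forall z, rho z v = v]
    (ex_intro _ S SP)).
pose Q (k : nat) := `[< exists S : {vspace V},
  (forall v, v \in S -> forall z, rho z v = v) /\ \dim S = k >].
have Q0 : exists k, Q k.
  exists 0%N; apply/asboolP; exists 0%VS; split; last exact: dimv0.
  by move=> u; rewrite memv0 => /eqP -> z; rewrite linear0.
have Qb k : Q k -> (k <= \dim {:V})%N.
  by move=> /asboolP[S [_ <-]]; apply/dimvS/subvf.
case: (ex_maxnP Q0 Qb) => k /asboolP[S [Sinv dS]] kmax.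
exists S => u; split; first exact: Sinv.
move=> uinv; have /kmax : Q (\dim (S + <[u]>)).
  apply/asboolP; exists (S + <[u]>)%VS; split => // x.
  move=> /memv_addP[s sS [y /vlineP[a ->] ->]] z.
  by rewrite linearD linearZ /= Sinv // uinv.
rewrite -dS => le_dim.
have /eqP -> : S == (S + <[u]>)%VS by rewrite eqEdim addvSl.
by apply: (subvP (addvSr S <[u]>%VS)); apply: memv_line.
Qed.

End Invariants.

End Representations.

(* Main.v *)
(** Let [f(z) = sum_i z^(k i)] and [g] be the characters of the two
    representations; they are real-valued symmetric Laurent polynomials. The
    dimension of the invariants of the [n]-th tensor power is the constant term
    of [f^n], i.e. the mean of [f^n] over the [N]-th roots of unity for any [N]
    exceeding the degree of [f^n]. If [f] and [g] differ then, both being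
    polynomials in [cos t], one of them, say [f], is strictly larger than the
    other for small [t <> 0]. After adding a constant both are nonnegative on
    the circle, still with equal means of all powers. By faithfulness [g] has a
    strict maximum at [1], so at a root of unity close enough to [1] the value
    of [f] exceeds that of [g], and the latter is at least as large as all
    values of [g] at points where [g] could be larger than [f]. For large [n]
    this makes the mean of [f^n] larger than that of [g^n], a contradiction.

    The weights of a representation are found at a root of unity
    [z_m = e^(2 pi i / 2^m)], whose image has finite order, hence is
    diagonalizable. By continuity the image of [z_m] has no eigenvalue of
    nonpositive real part for large [m], so the eigenspaces for [z_(m+1)] are
    those for [z_m]; the powers of all the [z_m] are dense in the circle. *)
Require Import Defs.
From HB Require Import structures.
From mathcomp Require Import all_boot all_order all_algebra.
From mathcomp Require Import complex polyrcf.
From mathcomp Require Import all_classical all_reals all_analysis.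
From mathcomp Require Import ring lra zify.

Set Implicit Arguments.
Unset Strict Implicit.
Unset Printing Implicit Defensive.

Import Order.TTheory GRing.Theory Num.Theory.
Import numFieldNormedType.Exports.

Local Open Scope classical_set_scope.
Local Open Scope ring_scope.
Local Open Scope complex_scope.

(** * Roots of unity *)

Section Cis.
Variable R : realType.
Implicit Types (t u : R) (k w : int) (n N j : nat).

Definition cis t : R[i] := cos t +i* sin t.

Lemma cis0 : cis 0 = 1.
Proof. by rewrite /cis cos0 sin0. Qed.

Lemma cisD t u : cis (t + u) = cis t * cis u.
Proof. by rewrite /cis cosD sinD; simpc; congr (_ +i* _); ring. Qed.

Lemma norm_cis t : `|cis t| = 1.
Proof. by rewrite normc_def /= cos2Dsin2 sqrtr1. Qed.

Lemma cis_neq0 t : cis t != 0.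
Proof. by rewrite -normr_eq0 norm_cis oner_eq0. Qed.

Lemma cisN t : cis (- t) = (cis t)^-1.
Proof.
apply: (mulfI (cis_neq0 t)); rewrite divff ?cis_neq0 //.
by rewrite -cisD subrr cis0.
Qed.

Lemma cisX t k : cis t ^ k = cis (k%:~R * t).
Proof.
have H n : cis t ^+ n = cis (n%:R * t).
  elim: n => [|n IH]; first by rewrite mul0r cis0.
  by rewrite exprS IH -cisD -natr1 mulrDl mul1r addrC.
case: k => n; first exact: H.
by rewrite NegzE -exprnN H -cisN mulrNz mulNr.
Qed.

(** The angle is taken nonnegative because it is later approximated by natural multiples of small
    angles. *)
Lemma cis_surj (z : R[i]) : `|z| = 1 -> exists2 t, 0 <= t & z = cis t.
Proof.
case: z => x y; rewrite normc_def /= => -[E].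
have {}E : x ^+ 2 + y ^+ 2 = 1.
  rewrite -[LHS]sqr_sqrtr ?addr_ge0 ?sqr_ge0 // E.
  by rewrite expr1n.
have xb : -1 <= x <= 1 by apply/andP; split; nra.
have ca : cos (acos x) = x by rewrite acosK // in_itv.
have sa : sin (acos x) = `|y|.
  by rewrite sin_acos // -E addrAC subrr add0r sqrtr_sqr.
have [y0|y0] := leP 0 y.
  by exists (acos x); [exact: acos_ge0|rewrite /cis ca sa ger0_norm].
exists (- acos x + pi *+ 2).
  by have := acos_lepi xb; have := @pi_ge0 R; rewrite mulr2n; lra.
by rewrite /cis cosD2pi sinD2pi cosN sinN ca sa ltr0_norm // opprK.
Qed.

Definition rangle N j : R := pi *+ 2 * j%:R / N%:R.

Lemma cis_2pi n : cis (pi *+ 2 * n%:R) = 1.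
Proof.
elim: n => [|n IH]; first by rewrite mulr0 cis0.
rewrite -natr1 mulrDr mulr1 cisD IH mul1r.
by rewrite /cis cos2pi sin2pi.
Qed.

Lemma cis_rangle_full N : (0 < N)%N -> cis (rangle N N) = 1.
Proof.
move=> N0; rewrite /rangle mulfK ?pnatr_eq0 -?lt0n //.
by rewrite -[pi *+ 2]mulr1 (cis_2pi 1).
Qed.

Lemma cos_lt1 t : 0 < t < pi *+ 2 -> cos t < 1.
Proof.
move=> /andP[t0 t1].
have -> : t = (t / 2) *+ 2 by rewrite -mulr_natr divfK ?pnatr_eq0.
have : 0 < sin (t / 2) by apply: sin_gt0_pi; move: t1; rewrite mulr2n; lra.
rewrite cos_mulr2n cos2sin2 => s0.
by rewrite mulr2n; nra.
Qed.

(** The angle [2 pi w / N] has absolute value strictly between [0] and [2 pi], where the cosine is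
    below [1]. *)
Lemma rangle1_pow_neq1 N w : w != 0 -> (absz w < N)%N -> cis (rangle N 1) ^ w != 1.
Proof.
move=> w0 wN; have N0 : (0 < N)%N by apply: leq_ltn_trans wN.
rewrite cisX; apply/eqP => -[+ _]; apply/eqP; rewrite lt_eqF //.
rewrite -cos_norm; apply: cos_lt1.
have N0R : 0 < N%:R :> R by rewrite ltr0n.
have p0 : 0 < pi *+ 2 :> R by rewrite pmulrn_lgt0 ?pi_gt0.
have w0R : 0 < `|w%:~R| :> R by rewrite normr_gt0 intr_eq0.
have wR : `|w%:~R| < N%:R :> R by rewrite -intr_norm -natr_absz ltr_nat.
have q0 : 0 < pi *+ 2 / N%:R :> R by exact: divr_gt0.
rewrite normrM /rangle mulr1 (gtr0_norm q0) mulr_gt0 //=.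
by rewrite mulrA ltr_pdivrMr // mulrC ltr_pM2l.
Qed.

Lemma rangleE N j : rangle N j = j%:~R * rangle N 1.
Proof. by rewrite /rangle mulr1 -[j%:~R]/(j%:R) mulrCA mulrA. Qed.

(** For [w != 0] this is a geometric sum whose ratio is an [N]-th root of unity other than [1]. It
    acts as an exact integral over the circle for Laurent polynomials of degree below [N]. *)
Lemma sum_rangle_pow N w : (absz w < N)%N ->
  \sum_(j < N) cis (rangle N j) ^ w = if w == 0 then N%:R else 0.
Proof.
move=> wN; have N0 : (0 < N)%N by apply: leq_ltn_trans wN.
have [->|w0] := eqVneq w 0.
  rewrite (eq_bigr (fun=> 1)) => [|j _]; last by rewrite expr0z.
  by rewrite sumr_const card_ord.
have E (j : nat) : cis (rangle N j) ^ w = (cis (rangle N 1) ^ w) ^+ j.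
  by rewrite rangleE -cisX exprnP !exprz_exp mulrC.
under eq_bigr do rewrite E.
set z := _ ^ w; have z1 : z - 1 != 0 by rewrite subr_eq0 rangle1_pow_neq1.
apply: (mulfI z1); rewrite mulr0 -subrX1 /z -E cis_rangle_full //.
by rewrite exp1rz subrr.
Qed.

End Cis.

(** * Comparison of power means *)

Section Growth.
Variable R : realType.

Lemma bernoulli_le (h : R) n : 0 <= h -> 1 + n%:R * h <= (1 + h) ^+ n.
Proof.
move=> h0; elim: n => [|n IH]; first by rewrite mul0r addr0.
rewrite exprSr -natr1; apply: le_trans (ler_wpM2r _ IH); last by rewrite addr_ge0.
have : 0 <= n%:R :> R by [].
by move: (n%:R : R) => x x0; nra.
Qed.

(** Bernoulli's inequality for [x ^ m] is only linear in [m]; squaring it, with [n = 2 m], gives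
    [(m h) ^ 2], which beats [2 K m] once [m h ^ 2 > 2 K]. *)
Lemma expr_outgrows_linear (x : R) (K : nat) : 1 < x ->
  exists2 n, (0 < n)%N & (K * n)%:R < x ^+ n.
Proof.
move=> x1; have h0 : 0 < x - 1 by rewrite subr_gt0.
set h := x - 1 in h0.
have [m /andP[m0 mh]] : exists m : nat, (0 < m)%N && ((K.*2)%:R < m%:R * h ^+ 2).
  have h2 : 0 < h ^+ 2 by rewrite exprn_gt0.
  pose b := Num.bound ((K.*2)%:R / h ^+ 2); exists b.+1.
  rewrite -ltr_pdivrMr //; apply: (@lt_trans _ _ b%:R); last by rewrite ltr_nat.
  by rewrite archi_boundP // divr_ge0 // ltW.
exists m.*2; first by rewrite double_gt0.
have := bernoulli_le m (ltW h0); rewrite /h subrKC -/h => B.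
have -> : x ^+ m.*2 = (x ^+ m) ^+ 2 by rewrite -exprM muln2.
have M0 : 0 < m%:R :> R by rewrite ltr0n.
have -> : (K * m.*2)%:R = (K.*2)%:R * m%:R :> R.
  by rewrite -natrM -!muln2; congr _%:R; lia.
apply: lt_le_trans (_ : (m%:R * h) ^+ 2 <= _).
  by rewrite exprMn (expr2 m%:R) -mulrA mulrC ltr_pM2l.
rewrite ler_pXn2r // ?nnegrE.
- by apply: le_trans B; rewrite lerDr.
- by rewrite mulr_ge0 // ltW.
- by rewrite exprn_ge0 //; lra.
Qed.

(** With [a] the last root in [(0, 1)], or [0], the sign of [p] is constant on [(a, 1)]; a strictly
    opposite sign at [1] would force another root. *)
Lemma horner_sign_left1 (p : {poly R}) : p != 0 ->
  exists2 a, 0 <= a < 1 &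
    (forall x, a < x <= 1 -> 0 <= p.[x]) /\ (forall x, a < x < 1 -> 0 < p.[x]) \/
    (forall x, a < x <= 1 -> p.[x] <= 0) /\ (forall x, a < x < 1 -> p.[x] < 0).
Proof.
move=> p0; pose a := Num.max 0 (prev_root p 0 1).
have a1 : a < 1 by rewrite gt_max ltr01 prev_root_lt.
have a0 : 0 <= a by rewrite le_max lexx.
have inn x : a < x < 1 -> x \in neighpl p 0 1.
  by rewrite /neighpl in_itv /= gt_max -andbA => /and3P[_ -> ->].
pose m := (a + 1) / 2; have am : a < m < 1 by rewrite /m; apply/andP; split; lra.
have nr x : a < x < 1 -> p.[x] != 0 by move=> /inn/neighpl_root.
have sg x : a < x < 1 -> Num.sg p.[x] = Num.sg p.[m].
  by move=> ax; apply: (@sgr_neighpl_same _ p 0 1); exact: inn.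
have end1 : p.[m] * p.[1] < 0 -> False.
  move=> /poly_ivtoo; case; first by case/andP: am => _ /ltW.
  move=> x; rewrite in_itv /= => /andP[mx x1]; rewrite rootE; apply/negP/nr.
  by rewrite x1 andbT (lt_trans _ mx) //; case/andP: am.
have H x : a < x <= 1 -> x = 1 \/ a < x < 1.
  by move=> /andP[-> +]; rewrite le_eqVlt => /predU1P[->|->]; [left|right].
exists a; first by rewrite a0.
have := nr _ am; rewrite neq_lt => /orP[pm|pm]; [right|left].
  have S x : a < x < 1 -> p.[x] < 0 by move=> /sg E; rewrite -sgr_lt0 E sgr_lt0.
  split=> // x /H [->|/S/ltW//].
  by rewrite leNgt; apply/negP => p1; apply: end1; rewrite nmulr_rlt0.
have S x : a < x < 1 -> 0 < p.[x] by move=> /sg E; rewrite -sgr_gt0 E sgr_gt0.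
split=> // x /H [->|/S/ltW//].
by rewrite leNgt; apply/negP => p1; apply: end1; rewrite pmulr_rlt0.
Qed.

Lemma cvg_rangle1 : rangle R n 1 @[n --> \oo] --> (0 : R).
Proof.
rewrite /rangle -(mulr0 (pi *+ 2 * 1%:R)).
apply: cvgM; first exact: cvg_cst.
apply/gtr0_cvgV0; last exact: cvgr_idn.
by near=> n; rewrite ltr0n; near: n; exact: nbhs_infty_gt.
Unshelve. all: by end_near. Qed.

(** The maximum of [q] on the compact [[-1, a]] is attained and lies below [q.[1]], while
    [cos (2 pi / N)] tends to [1] as [N] grows. *)
Lemma horner_left1_rangle (q : {poly R}) (a : R) : 0 <= a < 1 ->
  (forall x, -1 <= x < 1 -> q.[x] < q.[1]) ->
  exists2 N, (0 < N)%N & a < cos (rangle R N 1) < 1 /\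
    forall x, -1 <= x <= a -> q.[x] <= q.[cos (rangle R N 1)].
Proof.
move=> /andP[a0 a1] qmax.
have ab : -1 <= a by lra.
have [c] := @EVT_max R (horner q) _ _ ab
  (continuous_subspaceT (@continuous_horner _ q)).
rewrite in_itv /= => /andP[c1 ca] cmax.
have qc : q.[c] < q.[1] by apply: qmax; rewrite c1 (le_lt_trans ca).
have cosc : cos (rangle R n 1) @[n --> \oo] --> (1 : R).
  rewrite -[X in _ --> X]cos0.
  by apply: continuous_cvg; [exact: continuous_cos|exact: cvg_rangle1].
have qcos : q.[cos (rangle R n 1)] @[n --> \oo] --> (q.[1] : R).
  by apply: continuous_cvg; [exact: continuous_horner|exact: cosc].
have : \forall N \near \oo, (1 < N)%N /\ a < cos (rangle R N 1) /\
    q.[c] < q.[cos (rangle R N 1)].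
  near=> N; split; [|split]; near: N; first exact: nbhs_infty_gt.
    exact: (cvgr_gt _ cosc).
  exact: (cvgr_gt _ qcos).
move=> [N _ /(_ N (leqnn N))] [N1 [aN qN]].
have N0 : (0 < N)%N by apply: ltn_trans N1.
exists N => //; split.
  rewrite aN /=; apply: cos_lt1; rewrite /rangle mulr1.
  have p0 : 0 < pi *+ 2 :> R by rewrite pmulrn_lgt0 ?pi_gt0.
  by rewrite divr_gt0 ?ltr0n //= ltr_pdivrMr ?ltr0n // ltr_pMr // ltr1n.
move=> x xa; apply: le_trans (ltW qN); apply: cmax.
by rewrite in_itv.
Unshelve. all: by end_near. Qed.

(* For large [n] the mean of [p(cos)^n] exceeds that of [q(cos)^n]: a root of
   unity close to [1], where [p] takes the value [A] and [q] the value [B < A],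
   contributes [(A^n - B^n) / N] to the difference, the points with [p < q]
   contribute at least [- B^n], and [N] grows only linearly in [n]. *)
Lemma power_means_separate (p q : {poly R}) (B : nat) (a : R) : 0 <= a < 1 ->
  (forall x, -1 <= x <= 1 -> 0 <= p.[x]) ->
  (forall x, -1 <= x <= 1 -> 0 <= q.[x]) ->
  (forall x, -1 <= x < 1 -> q.[x] < q.[1]) ->
  (forall x, a < x <= 1 -> q.[x] <= p.[x]) ->
  (forall x, a < x < 1 -> q.[x] < p.[x]) ->
  ~ (forall n N, (n * B < N)%N -> \sum_(j < N) p.[cos (rangle R N j)] ^+ n =
                                  \sum_(j < N) q.[cos (rangle R N j)] ^+ n).
Proof.
move=> a01 p0 q0 qmax pq pq' H.
have [N0 N00 [xs qs]] := horner_left1_rangle a01 qmax.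
set x := cos _ in xs qs.
have cos_itv (t : R) : -1 <= cos t <= 1 by rewrite cos_geN1 cos_le1.
have qxp : q.[x] < p.[x] by apply: pq'.
have qx0 : 0 <= q.[x] by apply: q0; apply: cos_itv.
have px0 : 0 < p.[x] := le_lt_trans qx0 qxp.
have bnd n : (0 < n)%N -> p.[x] ^+ n <= (N0 * (n * B).+1)%:R * q.[x] ^+ n.
  (* [N] exceeds [n * B], as [H] requires, and is a multiple of [N0], so the angle of index
     [n * B + 1] is [2 pi / N0]. *)
  move=> n0; set N := (N0 * (n * B).+1)%N.
  have nN : (n * B < N)%N by rewrite /N; nia.
  have [N1|N1] := eqVneq N0 1%N.
    exfalso; move: xs; rewrite /x N1 /rangle mulr1 divr1 cos2pi ltxx andbF //.
  have jN : ((n * B).+1 < N)%N by rewrite /N; nia.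
  pose j0 := Ordinal jN.
  have xj0 : cos (rangle R N j0) = x.
    by congr cos; rewrite /rangle /= mulr1 natrM -mulf_div divff ?mulr1 ?pnatr_eq0.
  have /eqP := H n N nN; rewrite -subr_eq0 -sumrB (bigD1 j0) //= xj0.
  rewrite addr_eq0 => /eqP E.
  have : - \sum_(i < N | i != j0) (p.[cos (rangle R N i)] ^+ n -
     q.[cos (rangle R N i)] ^+ n) <= \sum_(i < N | i != j0) q.[x] ^+ n.
    rewrite -sumrN; apply: ler_sum => i _; rewrite opprB.
    (* Up to [a], [q] is at most [q.[x]] and the power of [p] is nonnegative; beyond [a], [p]
       dominates [q] and the difference is at most [0]. *)
    have [ia|ia] := leP (cos (rangle R N i)) a.
      rewrite lerBlDr; apply: le_trans (_ : q.[x] ^+ n <= _); last first.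
        by rewrite lerDl exprn_ge0 // p0 ?cos_itv.
      rewrite ler_pXn2r ?nnegrE ?q0 ?cos_itv //.
      by apply: qs; rewrite ia cos_geN1.
    rewrite lerBlDr; apply: le_trans (_ : p.[cos (rangle R N i)] ^+ n <= _).
      rewrite ler_pXn2r ?nnegrE ?q0 ?p0 ?cos_itv //.
      by apply: pq; rewrite ia cos_le1.
    by rewrite lerDr exprn_ge0.
  rewrite -E lerBlDr.
  have -> : \sum_(i < N | i != j0) q.[x] ^+ n + q.[x] ^+ n = N%:R * q.[x] ^+ n.
    rewrite -[N in RHS]card_ord mulr_natl -sumr_const [RHS](bigD1 j0) //=.
    exact: addrC.
  by [].
(* The growth argument divides by [q.[x]]; if that is [0], the bound for [n = 1] already contradicts
   [p.[x] > 0]. *)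
have [qx|qx] := eqVneq q.[x] 0.
  have := bnd 1%N isT; rewrite qx !expr1 mulr0 => /(lt_le_trans px0).
  by rewrite ltxx.
have {}qx0 : 0 < q.[x] by rewrite lt_neqAle eq_sym qx.
have r1 : 1 < p.[x] / q.[x] by rewrite ltr_pdivlMr // mul1r.
(* For positive [n], [N0 * (n * B + 1)] is at most [N0 * (B + 1) * n]. *)
have [n n0] := expr_outgrows_linear (N0 * B.+1) r1.
rewrite expr_div_n ltr_pdivlMr ?exprn_gt0 //.
move=> /lt_le_trans/(_ (bnd n n0)); rewrite ltr_pM2r ?exprn_gt0 // ltr_nat.
apply/negP; rewrite -leqNgt; nia.
Qed.

End Growth.

(** * Trigonometric sums *)

Section TrigonometricSums.
Variable R : realType.

(** The character of a representation with weights [k], at the point of angle [t]. *)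
Definition chi (I : finType) (k : I -> int) (t : R) : R[i] :=
  \sum_i cis t ^ k i.

(** The constant term of the [n]-th power of the Laurent polynomial [chi k]. *)
Definition zero_sum_count (I : finType) (k : I -> int) (n : nat) : nat :=
  #|[pred f : {ffun 'I_n -> I} | \sum_i k (f i) == 0]|.

Lemma cis_sum (J : Type) (r : seq J) (F : J -> int) (t : R) :
  cis t ^ (\sum_(i <- r) F i) = \prod_(i <- r) cis t ^ F i.
Proof.
elim/big_rec2: _ => [|i x y _ <-]; first by rewrite expr0z.
by rewrite expfzDr // cis_neq0.
Qed.

Lemma absz_sum_le (n B : nat) (F : 'I_n -> int) :
  (forall i, absz (F i) <= B)%N -> (absz (\sum_i F i)%R <= n * B)%N.
Proof.
move=> FB; rewrite -lez_nat abszE; apply: le_trans (ler_norm_sum _ _ _) _.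
apply: le_trans (_ : \sum_(i < n) B%:Z <= _).
  by apply: ler_sum => i _; rewrite -abszE lez_nat.
by rewrite sumr_const card_ord PoszM -mulr_natl natz.
Qed.

(** The exponents in the expanded power have absolute value at most [n * B < N], so summing over the
    roots of unity retains exactly those equal to [0]. *)
Lemma sum_chi_pow (I : finType) (k : I -> int) (B n N : nat) :
  (forall i, absz (k i) <= B)%N -> (n * B < N)%N ->
  \sum_(j < N) chi k (rangle R N j) ^+ n = (N * zero_sum_count k n)%:R.
Proof.
move=> kB nB.
have E t : chi k t ^+ n = \sum_(f : {ffun 'I_n -> I}) cis t ^ (\sum_i k (f i)).
  under eq_bigr do rewrite cis_sum.
  by rewrite -(bigA_distr_bigA (fun _ i => cis t ^ k i)) prodr_const card_ord.
under eq_bigr do rewrite E.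
rewrite exchange_big /= natrM mulr_natr /zero_sum_count -sumr_const.
rewrite [RHS]big_mkcond /=; apply: eq_bigr => f _.
rewrite sum_rangle_pow // (leq_ltn_trans _ nB) //.
exact: absz_sum_le.
Qed.

(** A discrete Fourier coefficient: it reads the multiplicity of the weight [w] off the values of
    the character. *)
Lemma sum_chi_coef (I : finType) (k : I -> int) (w : int) (B N : nat) :
  (forall i, absz (k i) <= B)%N -> (absz w + B < N)%N ->
  \sum_(j < N) cis (rangle R N j) ^ (- w) * chi k (rangle R N j) =
  N%:R * (count_mem w (codom k))%:R.
Proof.
move=> kB wN; under eq_bigr do rewrite mulr_sumr.
rewrite exchange_big /= -sum1_count big_map natr_sum mulr_sumr.
rewrite [RHS]big_mkcond -[index_enum _]enumT /=; apply: eq_bigr => i _.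
under eq_bigr do rewrite -expfzDr ?cis_neq0 //.
rewrite sum_rangle_pow; last by have := kB i; lia.
by rewrite addrC subr_eq0 mulr1.
Qed.

Lemma eq_chi_perm (I J : finType) (k : I -> int) (l : J -> int) :
  chi k =1 chi l -> perm_eq (codom k) (codom l).
Proof.
move=> kl; apply/permP => /= p.
have bounded (T : finType) (m : T -> int) : exists B, forall i, (absz (m i) <= B)%N.
  by exists (\max_i absz (m i)) => i; apply: leq_bigmax.
have [[B kB] [B' lB]] := (bounded _ k, bounded _ l).
have H w : count_mem w (codom k) = count_mem w (codom l).
  pose N := (absz w + (B + B')).+1.
  have N0 : N%:R != 0 :> R[i] by rewrite pnatr_eq0.
  have := @sum_chi_coef _ k w (B + B') N _ (ltnSn _).
  under eq_bigr do rewrite kl.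
  rewrite (@sum_chi_coef _ l w (B + B') N _ (ltnSn _)).
    move=> /(_ (fun i => leq_trans (kB i) (leq_addr _ _)))/(mulfI N0)/eqP.
    by rewrite eqr_nat => /eqP.
  by move=> j; apply: leq_trans (lB j) (leq_addl _ _).
have : perm_eq (codom k) (codom l).
  by apply/allP => w _ /=; rewrite H.
by move/permP.
Qed.

(** These are the Chebyshev polynomials; their three-term recurrence makes the induction carry two
    consecutive ones. *)
Lemma cos_mulr_poly n : exists p : {poly R}, forall t, p.[cos t] = cos (n%:R * t).
Proof.
suff [p [_ [H _]]] : exists p q : {poly R}, (forall t, p.[cos t] = cos (n%:R * t)) /\
    forall t, q.[cos t] = cos (n.+1%:R * t) by exists p.
elim: n => [|n [p [q [pE qE]]]].
  by exists 1, 'X; split=> t; rewrite hornerE ?mul0r ?cos0 ?mul1r.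
exists q, ('X * q *+ 2 - p); split=> // t; rewrite !hornerE pE qE.
have -> : n.+2%:R * t = n.+1%:R * t + t by rewrite -(natr1 n.+1); ring.
have -> : n%:R * t = n.+1%:R * t - t by rewrite -natr1; ring.
by rewrite cosB cosD; ring.
Qed.

Lemma sum_cos_poly (I : finType) (k : I -> int) :
  exists p : {poly R}, forall t, p.[cos t] = \sum_i cos ((k i)%:~R * t).
Proof.
have H i : exists p : {poly R}, forall t, p.[cos t] = cos ((k i)%:~R * t).
  have [p pE] := cos_mulr_poly (absz (k i)); exists p => t; rewrite pE.
  case: (k i) => m //=; by rewrite NegzE mulrNz mulNr cosN.
have [p pE] := fin_all_exists H.
exists (\sum_i p i) => t; rewrite horner_sum.
by apply: eq_bigr.
Qed.

(** Adding the sum to its copy with [- k] cancels the sines. *)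
Lemma chi_sym_real (I : finType) (k : I -> int) (t : R) :
  perm_eq (codom k) (codom (fun i => - k i)) ->
  chi k t = (\sum_i cos ((k i)%:~R * t))%:C.
Proof.
move=> sym.
have E : chi k t = \sum_i cis t ^ (- k i).
  rewrite /chi -(big_map k xpredT (fun w => cis t ^ w)).
  rewrite -(big_map (fun i => - k i) xpredT (fun w => cis t ^ w)).
  by apply: perm_big; rewrite -[index_enum I]enumT.
apply: (@pmulrnI R[i] 2 isT).
rewrite mulr2n {2}E -big_split /= rmorph_sum -sumrMnl /=.
apply: eq_bigr => i _; rewrite !cisX mulrNz mulNr /cis cosN sinN.
by rewrite mulr2n; simpc.
Qed.

(** By the binomial theorem. The right-hand side depends on [k] only through the zero-sum counts, so
    equal counts give equal power means even after the shift by [c]. *)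
Lemma sum_chi_shift_pow (I : finType) (k : I -> int) (p : {poly R}) (B n N c : nat) :
  perm_eq (codom k) (codom (fun i => - k i)) ->
  (forall t, p.[cos t] = \sum_i cos ((k i)%:~R * t)) ->
  (forall i, absz (k i) <= B)%N -> (n * B < N)%N ->
  \sum_(j < N) (p + c%:R%:P).[cos (rangle R N j)] ^+ n =
  (N * \sum_(m < n.+1) c ^ (n - m) * zero_sum_count k m * 'C(n, m))%:R.
Proof.
move=> sym pE kB nB; apply: complexI; rewrite rmorph_sum [RHS]rmorph_nat /=.
transitivity (\sum_(j < N) \sum_(m < n.+1)
    (c%:R ^+ (n - m) * chi k (rangle R N j) ^+ m) *+ 'C(n, m)).
  apply: eq_bigr => j _; rewrite hornerD hornerC pE rmorphXn rmorphD /=.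
  by rewrite -chi_sym_real // rmorph_nat addrC exprDn.
rewrite exchange_big /= big_distrr natr_sum /=; apply: eq_bigr => m _.
rewrite sumrMnl -mulr_sumr (@sum_chi_pow _ _ B) //.
  by rewrite -natrX -natrM -mulrnA; congr _%:R; lia.
by apply: leq_ltn_trans nB; rewrite leq_mul2r -ltnS ltn_ord orbT.
Qed.

(** At [1] every cosine is [1]; equality elsewhere would make every [cis t ^ k i] equal to [1],
    against faithfulness. *)
Lemma sum_cos_strict_max (I : finType) (k : I -> int) (q : {poly R}) :
  (forall t : R, (forall i, cis t ^ k i = 1) -> cis t = 1) ->
  (forall t, q.[cos t] = \sum_i cos ((k i)%:~R * t)) ->
  forall x, -1 <= x < 1 -> q.[x] < q.[1].
Proof.
move=> faith qE x /andP[x0 x1].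
have -> : x = cos (acos x) by rewrite acosK // in_itv /= x0 ltW.
set t := acos x; have ct : cos t != 1.
  by rewrite acosK ?lt_eqF // in_itv /= x0 ltW.
have -> : q.[1] = \sum_(i : I) 1.
  by rewrite -cos0 qE; apply: eq_bigr => i _; rewrite mulr0 cos0.
rewrite qE lt_neqAle ler_sum ?andbT; last by move=> i _; exact: cos_le1.
apply: contra_neqN ct => // /eqP E.
suff /faith[] : forall i, cis t ^ k i = 1 by [].
have F : \sum_i (1 - cos ((k i)%:~R * t)) = 0 by rewrite sumrB E subrr.
have P i : 0 <= 1 - cos ((k i)%:~R * t) by rewrite subr_ge0 cos_le1.
move=> i; have : 1 - cos ((k i)%:~R * t) = 0 by apply: (psumr_eq0P _ F).

move=> /eqP; rewrite subr_eq0 cisX /cis => /eqP/esym c1.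
by rewrite c1 cos1sin0 // c1 normr1.
Qed.

Lemma zero_sum_count_perm (I J : finType) (k : I -> int) (l : J -> int) :
  perm_eq (codom k) (codom (fun i => - k i)) ->
  perm_eq (codom l) (codom (fun j => - l j)) ->
  (forall t : R, (forall i, cis t ^ k i = 1) -> cis t = 1) ->
  (forall t : R, (forall j, cis t ^ l j = 1) -> cis t = 1) ->
  (forall n, (0 < n)%N -> zero_sum_count k n = zero_sum_count l n) ->
  perm_eq (codom k) (codom l).
Proof.
move=> ksym lsym kf lf H.
(* The binomial expansion of the shifted powers also involves exponent [0], where both counts are
   [1]. *)
have {}H n : zero_sum_count k n = zero_sum_count l n.
  case: n => [|n]; last exact: H.
  by rewrite /zero_sum_count !eq_cardT -?cardT ?card_ffun ?card_ord // => f;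
     rewrite inE big_ord0.
have [p pE] := sum_cos_poly k; have [q qE] := sum_cos_poly l.
apply: eq_chi_perm => t; rewrite !chi_sym_real // -pE -qE.
suff /eqP -> : p == q by [].
apply/negPn/negP => pq.
(* A sum of cosines is at least minus its number of terms, so adding [c] makes both polynomials
   nonnegative on [[-1, 1]]. *)
pose c := (#|I| + #|J|)%N.
pose B := (\max_i absz (k i) + \max_j absz (l j))%N.
have kB i : (absz (k i) <= B)%N by apply: leq_trans (leq_addr _ _); apply: leq_bigmax.
have lB j : (absz (l j) <= B)%N by apply: leq_trans (leq_addl _ _); apply: leq_bigmax.
pose p' := p + c%:R%:P; pose q' := q + c%:R%:P.
have means n N : (n * B < N)%N ->
    \sum_(j < N) p'.[cos (rangle R N j)] ^+ n =
    \sum_(j < N) q'.[cos (rangle R N j)] ^+ n.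
  move=> nN; rewrite (sum_chi_shift_pow _ ksym pE kB nN).
  rewrite (sum_chi_shift_pow _ lsym qE lB nN).
  by congr (_ * _)%:R; apply: eq_bigr => m _; rewrite H.
have nonneg (T : finType) (m : T -> int) (r : {poly R}) :
    (forall t, r.[cos t] = \sum_i cos ((m i)%:~R * t)) -> (#|T| <= c)%N ->
    forall x, -1 <= x <= 1 -> 0 <= (r + c%:R%:P).[x].
  move=> rE Tc x xb; rewrite -(@acosK _ x) ?in_itv // hornerD hornerC rE.
  rewrite -lerBlDr sub0r; apply: le_trans (_ : - #|T|%:R <= _).
    by rewrite lerN2 ler_nat.
  rewrite -sumr_const -sumrN; apply: ler_sum => i _; exact: cos_geN1.
have p0 := nonneg _ _ _ pE (leq_addr _ _).
have q0 := nonneg _ _ _ qE (leq_addl _ _).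
have shift (r : {poly R}) x : (r + c%:R%:P).[x] = r.[x] + c%:R by rewrite hornerD hornerC.
have pm x : -1 <= x < 1 -> p'.[x] < p'.[1].
  by rewrite !shift ltrD2r; apply: sum_cos_strict_max kf pE _.
have qm x : -1 <= x < 1 -> q'.[x] < q'.[1].
  by rewrite !shift ltrD2r; apply: sum_cos_strict_max lf qE _.
have pq0 : p - q != 0 by rewrite subr_eq0.
(* Equality of means is symmetric, so whichever of [p] and [q] is larger just left of [1] plays the
   larger one in the comparison. *)
have [a a01 [[ge gt]|[ge gt]]] := horner_sign_left1 pq0.
  apply: (@power_means_separate R p' q' B a) => // x xa.
    by rewrite !shift lerD2r; have := ge x xa; rewrite !hornerE subr_ge0.
  by rewrite !shift ltrD2r; have := gt x xa; rewrite !hornerE subr_gt0.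
apply: (@power_means_separate R q' p' B a) => // [x xa|x xa|n N nN].
- by rewrite !shift lerD2r; have := ge x xa; rewrite !hornerE subr_le0.
- by rewrite !shift ltrD2r; have := gt x xa; rewrite !hornerE subr_lt0.
- by rewrite means.
Qed.

End TrigonometricSums.

(** * Decomposition of representations into weights *)

Section CircleParametrization.
Variable R : realType.

Definition U1cis (t : R) : U1 R := U1mk (norm_cis t : `|(cis t : R[i]^o)| = 1).

Lemma U1val_cis t : U1val (U1cis t) = cis t.
Proof. by []. Qed.

Lemma U1cis0 : U1cis 0 = 1%g.
Proof. by apply: U1val_inj; rewrite U1val_cis cis0. Qed.

Lemma U1cisD t u : U1cis (t + u) = (U1cis t * U1cis u)%g.
Proof. by apply: U1val_inj; rewrite U1val_cis cisD. Qed.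

Lemma U1cis_surj (z : U1 R) : exists2 t, 0 <= t & z = U1cis t.
Proof.
have [t t0 zt] := cis_surj (U1val_norm z); exists t => //.
exact: U1val_inj.
Qed.

Lemma real_complex_continuous : continuous ((fun x : R => x%:C) : R -> R[i]^o).
Proof.
move=> x; apply/cvgrPdist_lt => e; rewrite ltcE /= => /andP[/eqP e0 e1].
near=> y; rewrite -rmorphB normc_def /= expr0n addr0 sqrtr_sqr.
rewrite ltcE /= e0 eqxx /=; near: y.
have /cvgrPdist_lt H : y @[y --> x] --> x by exact: cvg_id.
exact: H.
Unshelve. all: by end_near. Qed.

Lemma cis_continuous : continuous (@cis R : R -> R[i]^o).
Proof.
have -> : (@cis R : R -> R[i]^o) = fun t => (cos t)%:C + (sin t)%:C * 'i%C.
  by apply/funext => t; rewrite /cis; simpc.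
move=> t; apply: cvgD; last apply: cvgM; last exact: cvg_cst.
- apply: (@continuous_comp _ _ _ (@cos R) (fun x => x%:C : R[i]^o)).
    exact: continuous_cos.
  exact: real_complex_continuous.
- apply: (@continuous_comp _ _ _ (@sin R) (fun x => x%:C : R[i]^o)).
    exact: continuous_sin.
  exact: real_complex_continuous.
Qed.

Lemma U1cis_continuous : continuous U1cis.
Proof. by apply: continuous_comp_initial; exact: cis_continuous. Qed.

End CircleParametrization.

(** * Eigenvectors at roots of unity *)

Section Weights.
Variables (R : realType) (V : vectType R[i]) (rho : u1rep V).
Local Notation C := R[i].
Implicit Types (v : V) (k : int) (t : R).

(** Near [1] the matrix of [rho z] differs from the identity by less than [e] in each entry. So the
    sum [S] of the absolute values of the coordinates of [v] satisfies [|1 + l| * S <= d * e * S],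
    where [|1 + l| >= 1] and [d * e < 1]. *)
Lemma near1_no_eigen : \forall z \near (1%g : U1 R), forall v (l : C),
  0 <= complex.Re l -> rho z v = - l *: v -> v = 0.
Proof.
pose d := \dim {:V}; pose X := vbasis {:V}.
pose e : C := (d.+1%:R)^-1.
have e0 : 0 < e by rewrite invr_gt0 ltr0n.
have H : \forall z \near (1%g : U1 R), forall ij : 'I_d * 'I_d,
    `|(ij.1 == ij.2)%:R - coord X ij.1 (rho z X`_ij.2)| < e.
  apply: (@filter_forall _ _ _ _ (nbhs_filter (1%g : U1 R))) => -[i j] /=.
  have /cvgrPdist_lt/(_ e e0) :=
    @rep_continuous _ _ rho X`_j (linfun (coord X i : V -> C^o)) 1%g.
  apply: filterS => z; rewrite !lfunE rep1 id_lfunE /= coord_free ?(eq_sym j) //.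
  exact: basis_free (vbasisP _).
apply: filterS H => z Hz v l l0 E.
pose S := \sum_i `|coord X i v|.
have S0 : 0 <= S by apply: sumr_ge0.
have le : `|1 + l| * S <= d%:R * e * S.
  rewrite /S mulr_sumr; apply: le_trans (_ : \sum_(i < d) e * S <= _); last first.
    by rewrite sumr_const card_ord -mulrA mulr_natl.
  apply: ler_sum => i _; rewrite -normrM.
  have -> : (1 + l) * coord X i v =
      \sum_(j < d) ((i == j)%:R - coord X i (rho z X`_j)) * coord X j v.
    transitivity (coord X i (v - rho z v)).
      have -> : v - rho z v = (1 + l) *: v by rewrite E scaleNr opprK scalerDl scale1r.
      by rewrite linearZ.
    have -> : coord X i (v - rho z v) = coord X i v - coord X i (rho z v).
      exact: linearB.
    have -> : coord X i (rho z v) = \sum_(j < d) coord X i (rho z X`_j) * coord X j v.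
      rewrite {1}(coord_vbasis (memvf v)) !linear_sum.
      by apply: eq_bigr => j _; rewrite !linearZ; exact: mulrC.
    have -> : coord X i v = \sum_(j < d) (i == j)%:R * coord X j v.
      rewrite (bigD1 i) //= eqxx mul1r big1 ?addr0 // => j /negbTE ji.
      by rewrite eq_sym ji mul0r.
    by rewrite -sumrB; apply: eq_bigr => j _; rewrite mulrBl.
  apply: le_trans (ler_norm_sum _ _ _) _; rewrite mulr_sumr.
  by apply: ler_sum => j _; rewrite normrM ler_wpM2r // ltW // (Hz (i, j)).
have l1 : 1 <= `|1 + l|.
  apply: le_trans (normc_ge_Re _); rewrite lecE /= eqxx /=.
  rewrite raddfD /= ger0_norm; last by rewrite addr_ge0.
  by rewrite lerDl.
have S00 : S = 0.
  apply/eqP; rewrite -[_ == _]negbK; apply/negP => Sn0.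
  have {}Sn0 : 0 < S by rewrite lt_neqAle eq_sym Sn0.
  have : S <= d%:R * e * S.
    by apply: le_trans le; rewrite -[X in X <= _]mul1r ler_wpM2r.
  rewrite -[X in X <= _]mul1r ler_pM2r // /e ler_pdivlMr ?ltr0n // mul1r.
  by rewrite ler_nat ltnn.
rewrite (coord_vbasis (memvf v)) big1 // => i _.
have := psumr_eq0P (fun i _ => normr_ge0 (coord X i v)) S00.
by move=> /(_ i isT)/eqP; rewrite normr_eq0 => /eqP ->; rewrite scale0r.
Qed.

Lemma near_angle_no_eigen : exists n0, forall n, (n0 <= n)%N ->
  forall v (l : C), 0 <= complex.Re l -> rho (U1cis (rangle R n 1)) v = - l *: v -> v = 0.
Proof.
have : U1cis (rangle R n 1) @[n --> \oo] --> (1%g : U1 R).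
  rewrite -U1cis0; apply: (@cvg_comp _ _ _ (fun n => rangle R n 1) (@U1cis R)).
    exact: cvg_rangle1.
  exact: U1cis_continuous.
by move=> /(_ _ near1_no_eigen) [n0 _ H]; exists n0 => n /H.
Qed.

(** The difference of the two sides is an eigenvector of [rho (U1cis t)] for [- cis t ^ k], or zero;
    as [cis t ^ k] has real part [cos (k t) >= 0], it is zero. *)
Lemma eigen_halve t k v : rho (U1cis (t *+ 2)) v = cis (t *+ 2) ^ k *: v ->
  (forall v (l : C), 0 <= complex.Re l -> rho (U1cis t) v = - l *: v -> v = 0) ->
  0 <= cos (k%:~R * t) ->
  rho (U1cis t) v = cis t ^ k *: v.
Proof.
rewrite mulr2n U1cisD repM comp_lfunE cisD expfzMl => E noeig c0.
apply/eqP; rewrite -subr_eq0; apply/eqP.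
apply: (noeig _ (cis t ^ k)); first by rewrite cisX.
rewrite linearB linearZ /= E -scalerA scaleNr scalerBr opprB.
by [].
Qed.

(* The spectral projector of the finite-order operator [rho (e^(2 pi i / N))] *)
Definition root_proj N k v : V :=
  (N%:R : C)^-1 *: \sum_(j < N) cis (rangle R N j) ^ (- k) *:
    rho (U1cis (rangle R N j)) v.

(** The operator shifts the summation index by one, and the terms of index [0] and [N] agree. *)
Lemma root_proj_eigen N k v : (0 < N)%N ->
  rho (U1cis (rangle R N 1)) (root_proj N k v) =
  cis (rangle R N 1) ^ k *: root_proj N k v.
Proof.
move=> N0; rewrite /root_proj linearZ /= scalerA mulrC -scalerA; congr (_ *: _).
rewrite linear_sum /= scaler_sumr.
pose G z := cis (rangle R N 1) ^ k *: ((U1val z : C) ^ (- k) *: rho z v).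
pose F j := G (U1cis (rangle R N j)).
have S j : rangle R N j.+1 = rangle R N 1 + rangle R N j.
  by rewrite /rangle -mulrDl -mulrDr nat1r.
transitivity (\sum_(j < N) F j.+1).
  apply: eq_bigr => j _.
  rewrite /F /G (S j) U1val_cis U1cisD repM comp_lfunE cisD linearZ /=.
  rewrite expfzMl scalerA mulrA -expfzDr ?cis_neq0 // subrr expr0z mul1r.
  by [].
have FN : F N = F 0%N.
  apply: (f_equal G); apply: U1val_inj; rewrite !U1val_cis cis_rangle_full //.
  by rewrite /rangle mulr0 mul0r cis0.
case: N N0 @G @F S FN => // N _ G F S FN.
by rewrite [LHS]big_ord_recr [RHS]big_ord_recl FN addrC.
Qed.

(** After exchanging the sums, the inner one over [N] consecutive weights vanishes unless [j = 0].
    The offset [h] allows weights centred at [0]. *)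
Lemma sum_root_proj N h v : (0 < N)%N ->
  v = \sum_(i < N) root_proj N (i%:Z - h) v.
Proof.
move=> N0; rewrite -scaler_sumr exchange_big /=.
under eq_bigr do rewrite -scaler_suml.
have H (j : 'I_N) : \sum_(i < N) cis (rangle R N j) ^ (- (i%:Z - h)) =
    if j == 0 :> nat then N%:R else 0.
  (* Since [i] times the angle of index [j] is [j] times that of index [i], the sum over weights
     becomes one over roots of unity. *)
  transitivity (cis (rangle R N j) ^ h * \sum_(i < N) cis (rangle R N i) ^ (- j%:Z)).
    rewrite mulr_sumr; apply: eq_bigr => i _.
    rewrite opprB expfzDr ?cis_neq0 //; congr (_ * _).
    by rewrite !cisX; congr cis; rewrite !mulrNz !mulNr /rangle; congr (- _); ring.
  rewrite sum_rangle_pow; last by rewrite abszN; exact: ltn_ord.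
  rewrite oppr_eq0 eqz_nat; have [-> /=|_] := eqVneq (j : nat) 0%N; last by rewrite mulr0.
  by rewrite /rangle mulr0 mul0r cis0 exp1rz mul1r.
transitivity ((N%:R : C)^-1 *: \sum_(j < N)
    (if j == 0 :> nat then N%:R else 0) *: rho (U1cis (rangle R N j)) v); last first.
  by congr (_ *: _); apply: eq_bigr => j _; rewrite (H j).
case: N N0 {H} => // N _; rewrite big_ord_recl /= big1 ?addr0.
  rewrite scalerA mulVf ?pnatr_eq0 // scale1r.
  by rewrite /rangle mulr0 mul0r U1cis0 rep1 id_lfunE.
by move=> j _; rewrite scale0r.
Qed.

End Weights.

(** * Weight vectors for the whole circle *)

Section WeightVectors.
Variables (R : realType) (V : vectType R[i]) (rho : u1rep V).
Local Notation C := R[i].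
Implicit Types (v : V) (k : int) (t : R).

Definition weight_vector k v := forall z : U1 R, rho z v = (U1val z : C) ^ k *: v.

Local Notation dyadic m := (rangle R (2 ^ m) 1).

Lemma dyadicS m : dyadic m = dyadic m.+1 *+ 2.
Proof.
rewrite /rangle !mulr1 expnS natrM !mulr2n.
have m0 : (2 ^ m)%:R != 0 :> R by rewrite pnatr_eq0 -lt0n expn_gt0.
by field.
Qed.

Lemma dyadic_gt0 m : 0 < dyadic m.
Proof.
by rewrite /rangle mulr1 divr_gt0 ?ltr0n ?expn_gt0 // pmulrn_lgt0 ?pi_gt0.
Qed.

Lemma cvg_dyadic : dyadic m @[m --> \oo] --> (0 : R).
Proof.
apply: (@cvg_comp _ _ _ (fun m => (2 ^ m)%N) (fun n => rangle R n 1));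
  last exact: cvg_rangle1.
apply/cvgnyPge => n; near=> m; apply: leq_trans (ltnW (ltn_expl m (ltnSn 1))).
near: m; exact: nbhs_infty_ge.
Unshelve. all: by end_near. Qed.

(** Rounding down to a multiple of the dyadic angle leaves an error of at most that angle. *)
Lemma dyadic_approx t : 0 <= t ->
  exists j : nat -> nat, (j m)%:R * dyadic m @[m --> \oo] --> t.
Proof.
move=> t0; exists (fun m => Num.truncn (t / dyadic m)).
apply: (@squeeze_cvgr _ _ _ _ (fun m => t - dyadic m) (fun=> t)).
- near=> m; have d0 := dyadic_gt0 m.
  have /andP[le gt] := truncn_itv (divr_ge0 t0 (ltW d0)).
  rewrite -ler_pdivlMr // le andbT lerBlDr -{1}(divfK (lt0r_neq0 d0) t).
  rewrite -[X in _ <= _ + X]mul1r -mulrDl natr1 ler_pM2r //.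
  exact: ltW.
- rewrite -[X in _ --> X]subr0; apply: cvgB; first exact: cvg_cst.
  exact: cvg_dyadic.
- exact: cvg_cst.
Unshelve. all: by end_near. Qed.

Lemma rho_cis_natmul t (a : C) v n : rho (U1cis t) v = a *: v ->
  rho (U1cis (n%:R * t)) v = a ^+ n *: v.
Proof.
move=> E; elim: n => [|n IH]; first by rewrite mul0r U1cis0 rep1 id_lfunE scale1r.
rewrite -natr1 mulrDl mul1r U1cisD repM comp_lfunE E linearZ /= IH.
by rewrite scalerA -exprS.
Qed.

(** By density of the multiples of dyadic angles. Coordinates are compared one by one because
    continuity of [rho] is stated for matrix coefficients. *)
Lemma dyadic_weight_vector m0 k v :
  (forall m, (m0 <= m)%N -> rho (U1cis (dyadic m)) v = cis (dyadic m) ^ k *: v) ->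
  weight_vector k v.
Proof.
move=> H z; have [t t0 ->] := U1cis_surj z; rewrite U1val_cis.
have [j jt] := dyadic_approx t0.
pose u m := (j m)%:R * dyadic m.
have ut : u m @[m --> \oo] --> t by exact: jt.
rewrite (coord_vbasis (memvf (rho (U1cis t) v))) [RHS](coord_vbasis (memvf _)).
apply: eq_bigr => i _; congr (_ *: _); rewrite linearZ /=.
pose phi : 'Hom(V, C^o) := linfun (coord (vbasis {:V}) i : V -> C^o).
have phiE w : coord (vbasis {:V}) i w = phi w by rewrite lfunE.
rewrite !phiE.
have c1 : (phi (rho (U1cis (u m)) v) : C^o) @[m --> \oo] -->
    (phi (rho (U1cis t) v) : C^o).
  apply: (@cvg_comp _ _ _ u (fun t => phi (rho (U1cis t) v) : C^o)); first exact: ut.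
  apply: (@continuous_comp _ _ _ (@U1cis R) (fun z => phi (rho z v) : C^o)).
    exact: U1cis_continuous.
  exact: rep_continuous.
have c2 : (cis (k%:~R * u m) * phi v : C^o) @[m --> \oo] -->
    (cis (k%:~R * t) * phi v : C^o).
  apply: cvgM; last exact: cvg_cst.
  apply: (@cvg_comp _ _ _ (fun m => k%:~R * u m) (@cis R : R -> C^o));
    last exact: cis_continuous.
  by apply: cvgM; [exact: cvg_cst|exact: ut].
have e : \forall m \near \oo,
    (phi (rho (U1cis (u m)) v) : C^o) = cis (k%:~R * u m) * phi v.
  near=> m; rewrite /u (@rho_cis_natmul _ (cis (dyadic m) ^ k)).
    by rewrite linearZ /= cisX exprnP cisX; congr (cis _ * _); rewrite mulrCA.
  by apply: H; near: m; exact: nbhs_infty_ge.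
rewrite cisX; apply: cvg_unique c1 _; first exact: norm_hausdorff.
by apply: cvg_trans c2; apply: near_eq_cvg; near=> m; apply/esym; near: m.
Unshelve. all: by end_near. Qed.

Lemma weight_vectors_span : exists s : seq V,
  (forall x, x \in s -> exists k, weight_vector k x) /\ span s = fullv.
Proof.
have [n0 Hn0] := near_angle_no_eigen rho.
(* As [N = 2 h], the weights [w i] lie in [[-h, h)]. The halved angles are at most
   [2 pi / 2 ^ (n0 + 2)], so their product with [|w i|] is at most [pi / 2] and the cosine in
   [eigen_halve] is nonnegative. *)
pose N := (2 ^ n0.+1)%N; pose h := (2 ^ n0)%N.
have N0 : (0 < N)%N by rewrite expn_gt0.
pose w (i : 'I_N) : int := i%:Z - h%:Z.
have wh i : (absz (w i) <= h)%N.
  by have := ltn_ord i; rewrite /w {2}/N expnS -/h; lia.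
have pw i v : weight_vector (w i) (root_proj rho N (w i) v).
  apply: (@dyadic_weight_vector n0.+1) => m.
  elim: m => // m IH; rewrite leq_eqVlt => /predU1P[<-|lm].
    exact: root_proj_eigen.
  apply: eigen_halve.
  - rewrite -dyadicS; exact: IH.
  - apply: Hn0; apply: leq_trans (ltnW (ltn_expl _ (ltnSn 1))); lia.
  - apply: cos_ge0_pihalf; rewrite -ler_norml normrM -intr_norm -abszE.
    rewrite (gtr0_norm (dyadic_gt0 _)).
    apply: le_trans (_ : h%:R * dyadic n0.+2 <= _).
      apply: ler_pM => //; first exact: ltW (dyadic_gt0 _).
        by rewrite ler_nat.
      have p0 : 0 < pi *+ 2 :> R by rewrite pmulrn_lgt0 ?pi_gt0.
      rewrite /rangle !mulr1 ler_pM2l //.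
      by rewrite lef_pV2 ?posrE ?ltr0n ?expn_gt0 // ler_nat leq_exp2l.
    rewrite /rangle mulr1 !expnS -/h !natrM.
    have h0 : h%:R != 0 :> R by rewrite pnatr_eq0 -lt0n expn_gt0.
    by rewrite le_eqVlt; apply/orP; left; apply/eqP; rewrite mulr2n; field.
exists [seq root_proj rho N (w i) v | i <- enum 'I_N, v <- vbasis {:V}]; split.
  by move=> x /allpairsP[[i v] /= [_ _ ->]]; exists (w i).
apply/eqP; rewrite eqEsubv subvf /= -[X in (X <= _)%VS](span_basis (vbasisP fullv)).
apply/span_subvP => v vb; rewrite [v](sum_root_proj rho h v N0).
apply: memv_suml => i _; apply: memv_span; apply/allpairsP.
by exists (i, v); rewrite mem_enum.
Qed.

Lemma free_subseq_span (s : seq V) : exists s' : seq V,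
  [/\ {subset s' <= s}, free s' & span s' = span s].
Proof.
elim: s => [|x s [s' [sub fr sp]]]; first by exists [::]; rewrite nil_free.
have [xs|xs] := boolP (x \in span s').
  exists s'; split=> //; first by move=> y /sub; rewrite inE => ->; rewrite orbT.
  by rewrite span_cons -sp; apply/esym/addv_idPr; rewrite -memvE.
exists (x :: s'); split; first by move=> y; rewrite !inE => /predU1P[->|/sub ->];
  rewrite ?eqxx ?orbT.
  by rewrite free_cons xs.
by rewrite !span_cons sp.
Qed.

(** The dual basis [c] is part of the data, and [I] is an arbitrary finite type so that tensor
    powers can be indexed by functions. *)
Definition weight_basis (I : finType) (k : I -> int) (e : I -> V)
    (c : I -> 'Hom(V, C^o)) :=
  [/\ forall v, v = \sum_i (c i v : C) *: e i,
      forall i j, c i (e j) = (i == j)%:R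
    & forall i, weight_vector (k i) (e i)].

Definition has_weights (I : finType) (k : I -> int) :=
  exists (e : I -> V) (c : I -> 'Hom(V, C^o)), weight_basis k e c.

Lemma ex_weights : exists k : 'I_(\dim {:V}) -> int, has_weights k.
Proof.
have [s [sw ss]] := weight_vectors_span.
have [s' [sub fr sp]] := free_subseq_span s.
have bs : basis_of {:V} s' by rewrite /basis_of sp ss eqxx.
have sz : size s' == \dim {:V} by rewrite -ss -sp; apply/eqP/esym; apply/eqP; exact: fr.
pose X := Tuple sz.
have ex (i : 'I_(\dim {:V})) : exists k, weight_vector k X`_i.
  by apply: sw; apply: sub; apply: mem_nth; rewrite (eqP sz).
have [k kw] := fin_all_exists ex.
exists k, (fun i : 'I_(\dim {:V}) => X`_i), (fun i => linfun (coord X i : V -> C^o)).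
split=> //.
- move=> v; rewrite {1}(coord_basis (bs : basis_of _ X) (memvf v)).
  by apply: eq_bigr => i _; rewrite lfunE.
- by move=> i j; rewrite lfunE /= coord_free // eq_sym.
Qed.

End WeightVectors.

(** * Representations determined by their weights *)

Lemma ex_linfun (K : fieldType) (U W : vectType K) (F : U -> W) :
  linear F -> exists f : 'Hom(U, W), f =1 F.
Proof.
move=> Flin.
pose L : {linear U -> W} := HB.pack F (GRing.isLinear.Build _ _ _ _ F Flin).
by exists (linfun L) => u; rewrite lfunE.
Qed.

Section WeightSpaces.
Variables (R : realType) (V : vectType R[i]) (rho : u1rep V).
Local Notation C := R[i].
Variables (I : finType) (k : I -> int) (e : I -> V) (c : I -> 'Hom(V, C^o)).
Hypothesis wb : weight_basis rho k e c.

Lemma weight_basis_coord z i v : c i (rho z v) = (U1val z : C) ^ k i * c i v.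
Proof.
have [dec dual wt] := wb; rewrite {1}(dec v) !linear_sum (bigD1 i) //= big1 ?addr0.
  rewrite !linearZ /= wt linearZ /= dual eqxx.
  by apply: etrans (mulrC _ _) _; congr (_ * _); exact: mulr1.
move=> j ji; rewrite !linearZ /= wt linearZ /= dual eq_sym (negbTE ji).
by rewrite !scaler0.
Qed.

Lemma weight_vectorE w v :
  weight_vector rho w v <-> forall i, k i != w -> c i v = 0.
Proof.
have [dec dual wt] := wb; split=> [H i kiw|H z].
  (* A root of unity of order above [|k i - w|] tells the two weights apart. *)
  pose N := (absz (k i - w)).+1; pose z := U1cis (rangle R N 1).
  have zw : (U1val z : C) ^ (k i - w) != 1.
    by apply: rangle1_pow_neq1; rewrite ?subr_eq0.
  have z0 : (U1val z : C) != 0 := U1val_neq0 z.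
  have := weight_basis_coord z i v; rewrite H linearZ /= => /esym/eqP.
  rewrite -subr_eq0 -[X in _ - X]/((U1val z : C) ^ w * c i v) -mulrBl.
  rewrite mulf_eq0 => /orP[|/eqP //].
  rewrite -[k i](subrK w) expfzDr // -[X in _ - X]mul1r -mulrBl mulf_eq0.
  by rewrite subr_eq0 (negbTE zw) expfz_eq0 (negbTE z0) andbF.
rewrite (dec v) linear_sum scaler_sumr; apply: eq_bigr => i _.
have [kiw|/H ->] := eqVneq (k i) w; last by rewrite scale0r linear0 scaler0.
by rewrite linearZ /= wt kiw !scalerA mulrC.
Qed.

Lemma weight_basis_free r : uniq r -> free [seq e i | i <- r].
Proof.
have [dec dual wt] := wb.
elim: r => [|i r IH] /=; first by rewrite nil_free.
move=> /andP[ir /IH fr]; rewrite free_cons fr andbT; apply/negP.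
have /subvP H : (span [seq e i | i <- r] <= lker (c i))%VS.
  apply/span_subvP => _ /mapP[j jr ->]; rewrite memv_ker dual.
  by have [ij|_] := eqVneq i j; [move: ir; rewrite ij jr|].
by move/H; rewrite memv_ker dual eqxx oner_eq0.
Qed.

(** The multiplicity of [w] becomes the dimension of a space defined without the basis, which makes
    the weights unique up to order. *)
Lemma weight_space w : exists2 S : {vspace V},
  forall v, v \in S <-> weight_vector rho w v &
  \dim S = count_mem w (codom k).
Proof.
have [dec dual wt] := wb.
pose r := [seq i <- enum I | k i == w].
exists (span [seq e i | i <- r]); last first.
  have /eqP -> := weight_basis_free (filter_uniq (fun i => k i == w) (enum_uniq I)).
  by rewrite size_map size_filter /codom /image_mem [RHS]count_map.
move=> v; rewrite weight_vectorE; split=> [vS i kiw|H].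
  have /subvP/(_ v vS) : (span [seq e i | i <- r] <= lker (c i))%VS.
    apply/span_subvP => _ /mapP[j jr ->]; rewrite memv_ker dual.
    have [ij|_] //= := eqVneq i j.
    by move: jr; rewrite -ij mem_filter (negbTE kiw).
  by rewrite memv_ker => /eqP.
rewrite (dec v); apply: memv_suml => i _.
have [kiw|/H ->] := eqVneq (k i) w; last by rewrite scale0r mem0v.
by apply: memvZ; apply: memv_span; apply: map_f; rewrite mem_filter kiw eqxx mem_enum.
Qed.

End WeightSpaces.

(** * Weights of duals, tensor powers and invariants *)

Section WeightsOfRepresentations.
Variable R : realType.
Local Notation C := R[i].
Implicit Types (V W : vectType C) (I J : finType).

Lemma has_weights_dim V (rho : u1rep V) I (k : I -> int) w (S : {vspace V}) :
  has_weights rho k -> (forall v, v \in S <-> weight_vector rho w v) ->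
  \dim S = count_mem w (codom k).
Proof.
move=> [e [c wb]] HS; have [S' HS' <-] := weight_space wb w.
congr (\dim _); apply/vspaceP => v.
by apply/idP/idP => [/HS/HS'|/HS'/HS].
Qed.

Lemma has_weights_unique V (rho : u1rep V) I J (k : I -> int) (l : J -> int) :
  has_weights rho k -> has_weights rho l -> perm_eq (codom k) (codom l).
Proof.
move=> [e [c wb]] lw; apply/allP => w _ /=; apply/eqP.
have [S HS <-] := weight_space wb w.
exact: has_weights_dim lw HS.
Qed.

Lemma has_weights_iso V W (rho : u1rep V) (sigma : u1rep W) I (k : I -> int) :
  rep_iso rho sigma -> has_weights rho k -> has_weights sigma k.
Proof.
move=> [f [fbij frho]] [e [c [dec dual wt]]].
have fK : cancel f (f^-1)%VF.
  apply: lker0_lfunK; apply/lker0P; exact: bij_inj.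
have fVK : cancel (f^-1)%VF f.
  by move=> w; have [g _ gK] := fbij; rewrite -(gK w) fK.
exists (fun i => f (e i)), (fun i => c i \o f^-1)%VF; split.
- move=> w; rewrite -{1}(fVK w) {1}(dec ((f^-1)%VF w)) linear_sum.
  by apply: eq_bigr => i _; rewrite linearZ /= comp_lfunE.
- by move=> i j; rewrite comp_lfunE fK.
- by move=> i z; rewrite -frho wt linearZ.
Qed.

(** The dual basis serves as basis and the evaluations at [e i] as coordinates; the inverse in the
    dual action negates the weights. *)
Lemma has_weights_dual V (rho : u1rep V) I (k : I -> int) :
  has_weights rho k -> has_weights (dual_rep rho) (fun i => - k i).
Proof.
move=> [e [c wb]]; have [dec dual wt] := wb.
have ev (i : I) : exists f : 'Hom('Hom(V, C^o), C^o), forall p, f p = p (e i).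
  by apply: ex_linfun => a p q; rewrite add_lfunE scale_lfunE.
have {ev} [c' c'E] := fin_all_exists ev.
exists c, c'; split.
- move=> p; apply/lfunP => v; rewrite sum_lfunE {1}(dec v) linear_sum.
  apply: eq_bigr => i _; rewrite linearZ /= scale_lfunE c'E.
  exact: mulrC.
- by move=> i j; rewrite c'E dual eq_sym.
- move=> i z; apply/lfunP => v; rewrite /= /dual_rep_fun lfunE /= /dual_fun comp_lfunE.
  rewrite (weight_basis_coord wb) scale_lfunE -exprz_inv.
  by [].
Qed.

(** [perm_iotaP] matches positions in the two lists; enumerating [I] and [J] turns this into a map
    of indices. *)
Lemma perm_codom_bij I J (k : I -> int) (l : J -> int) :
  perm_eq (codom k) (codom l) -> exists2 g : I -> J, bijective g & l \o g =1 k.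
Proof.
move=> kl.
have szIJ : #|I| = #|J| by rewrite -(size_codom k) -(size_codom l) (perm_size kl).
have [s ps ks] := perm_iotaP 0 kl.
have ssz : size s = #|I| by rewrite (perm_size ps) size_iota size_codom.
have sz (i : I) : (enum_rank i < size s)%N by rewrite ssz.
have lt (i : I) : (nth 0%N s (enum_rank i) < #|J|)%N.
  by have := mem_nth 0%N (sz i); rewrite (perm_mem ps) mem_iota size_codom.
exists (fun i => enum_val (Ordinal (lt i))).
  apply: inj_card_bij; last by rewrite szIJ.
  move=> i j /enum_val_inj/(f_equal val)/eqP /=.
  by rewrite nth_uniq ?(perm_uniq ps) ?iota_uniq // => /eqP/val_inj/enum_rank_inj.
move=> i /=; rewrite -(nth_codom 0 l) /= -(nth_map _ 0 (fun j => (codom l)`_j)) //.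
by rewrite -ks nth_codom enum_rankK.
Qed.

Lemma rep_iso_weights V W (rho : u1rep V) (sigma : u1rep W) I J
    (k : I -> int) (l : J -> int) (g : I -> J) :
  bijective g -> l \o g =1 k ->
  has_weights rho k -> has_weights sigma l -> rep_iso rho sigma.
Proof.
move=> [g' gK g'K] lg [e [c [dec dual wt]]] [e' [c' [dec' dual' wt']]].
have [f fE] : exists f : 'Hom(V, W), f =1 fun v => \sum_i (c i v : C) *: e' (g i).
  apply: ex_linfun => a u v; rewrite scaler_sumr -big_split.
  by apply: eq_bigr => i _; rewrite linearP scalerDl scalerA.
pose f' w := \sum_i (c' (g i) w : C) *: e i.
have fe i : f (e i) = e' (g i).
  rewrite fE (bigD1 i) //= dual eqxx scale1r big1 ?addr0 // => j ji.
  by rewrite dual (negbTE ji) scale0r.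
exists f; split; last first.
  move=> z v; rewrite (dec v) !linear_sum; apply: eq_bigr => i _.
  by rewrite !linearZ /= wt linearZ /= fe wt' -[l (g i)]/((l \o g) i) lg.
exists f' => [v|w].
  rewrite /f' [RHS]dec; apply: eq_bigr => i _; congr (_ *: _).
  rewrite fE linear_sum (bigD1 i) //= linearZ /= dual' eqxx big1 ?addr0 ?[LHS]mulr1 //.
  move=> j ji; rewrite linearZ /= dual' (can_eq gK) eq_sym (negbTE ji).
  exact: mulr0.
rewrite /f' linear_sum [RHS]dec' (reindex g) /=.
  by apply: eq_bigr => i _; rewrite linearZ /= fe.
by exists g' => j _; [exact: gK|exact: g'K].
Qed.

Lemma pure_sum V n I (a : 'I_n -> I -> C) (u : I -> V) :
  pure (fun i => \sum_j a i j *: u j) =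
  \sum_(f : {ffun 'I_n -> I}) (\prod_i a i (f i)) *: pure (fun i => u (f i)).
Proof.
apply/ffunP => h; rewrite sum_ffunE ffunE.
transitivity (\prod_i \sum_j a i j * coord (vbasis {:V}) (h i) (u j)).
  apply: eq_bigr => i _; rewrite linear_sum; apply: eq_bigr => j _.
  exact: linearZ.
rewrite bigA_distr_bigA; apply: eq_bigr => f _.
by rewrite !ffunE big_split.
Qed.

Lemma has_weights_tensor V (rho : u1rep V) n I (k : I -> int) :
  has_weights rho k ->
  has_weights (tensor_rep n rho) (fun f : {ffun 'I_n -> I} => \sum_i k (f i)).
Proof.
move=> [e [c [dec dual wt]]]; pose X := vbasis {:V}.
(* The functional [q f] is the tensor product of the [c (f i)], written in the coordinates of
   [tensor]. *)
have form (f : {ffun 'I_n -> I}) : exists q : 'Hom(tensor V n, C^o), forall t,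
    q t = \sum_(h : {ffun 'I_n -> 'I_(\dim {:V})}) (t h : C) * \prod_i c (f i) X`_(h i).
  apply: ex_linfun => a s t; rewrite scaler_sumr -big_split; apply: eq_bigr => h _.
  by rewrite !ffunE mulrDl; congr (_ + _); rewrite -mulrA.
have {form} [q qE] := fin_all_exists form.
have q_pure f v : q f (pure v) = \prod_i c (f i) (v i).
  rewrite qE.
  transitivity (\sum_(h : {ffun 'I_n -> 'I_(\dim {:V})})
     \prod_i (coord X (h i) (v i) * c (f i) X`_(h i))).
    by apply: eq_bigr => h _; rewrite ffunE big_split.
  rewrite -(bigA_distr_bigA (fun i j => coord X j (v i) * c (f i) X`_j)).
  apply: eq_bigr => i _; rewrite [in RHS](coord_vbasis (memvf (v i))) linear_sum.
  by apply: eq_bigr => j _; rewrite linearZ.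
exists (fun f : {ffun 'I_n -> I} => pure (fun i => e (f i))), q; split.
- have lin (t : tensor V n) :
      t = \sum_(f : {ffun 'I_n -> I}) (q f t : C) *: pure (fun i => e (f i)).
    (* By linearity only tensors of vectors of [X] need expanding, which is [pure_sum] applied to
       [dec]. *)
    rewrite [LHS]tensor_basis.
    under [RHS]eq_bigr => f _.
      rewrite {1}(tensor_basis t) linear_sum scaler_suml.
      over.
    rewrite exchange_big /=; apply: eq_bigr => h _.
    under [RHS]eq_bigr do rewrite linearZ /= -scalerA.
    rewrite -scaler_sumr; congr (_ *: _).
    under [RHS]eq_bigr do rewrite q_pure.
    rewrite -(pure_sum (fun i j => c j X`_(h i)) e).
    by congr pure; apply/funext => i; exact: dec.
  exact: lin.
- move=> f g; rewrite q_pure; have [->|fg] := eqVneq f g.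
    by rewrite big1 // => i _; rewrite dual eqxx.
  have /existsP[i fgi] : [exists i, f i != g i].
    by apply: contra_neqT fg => /existsPn H; apply/ffunP => i; apply/eqP/negPn.
  by rewrite (bigD1 i) //= dual (negbTE fgi) mul0r.
- move=> f z; rewrite /= tensor_map_pure; apply/ffunP => h; rewrite !ffunE.
  transitivity (\prod_i ((U1val z : C) ^ k (f i) * coord X (h i) (e (f i)))).
    by apply: eq_bigr => i _; rewrite wt linearZ.
  rewrite big_split; congr (_ * _).
  have [t _ ->] := U1cis_surj z; rewrite U1val_cis.
  exact/esym/cis_sum.
Qed.

(** Invariant vectors are those of weight [0]. *)
Lemma dim_invariants V (rho : u1rep V) I (k : I -> int) : has_weights rho k ->
  \dim (invariants rho) = count_mem 0 (codom k).
Proof.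
move=> kw; apply: has_weights_dim kw _ => v; rewrite invariantsP.
by split=> H z; rewrite H expr0z scale1r.
Qed.

Lemma dim_tensor_invariants V (rho : u1rep V) n I (k : I -> int) :
  has_weights rho k ->
  \dim (invariants (tensor_rep n rho)) = zero_sum_count k n.
Proof.
move=> /(has_weights_tensor n)/dim_invariants ->.
by rewrite /codom /image_mem count_map /zero_sum_count cardE enumT size_filter.
Qed.

Lemma faithful_weights V (rho : u1rep V) I (k : I -> int) :
  has_weights rho k -> faithful rho ->
  forall t : R, (forall i, cis t ^ k i = 1) -> cis t = 1.
Proof.
move=> [e [c [dec dual wt]]] frho t k1.
have : rho (U1cis t) = rho 1%g.
  apply/lfunP => v; rewrite rep1 id_lfunE (dec v) linear_sum.
  by apply: eq_bigr => i _; rewrite linearZ /= wt U1val_cis k1 scale1r.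
by move/frho/(f_equal (@U1val R)).
Qed.

Lemma self_dual_weights V (rho : u1rep V) I (k : I -> int) :
  has_weights rho k -> self_dual rho ->
  perm_eq (codom k) (codom (fun i => - k i)).
Proof.
move=> kw /has_weights_iso/(_ kw) kw'.
exact: has_weights_unique kw' (has_weights_dual kw).
Qed.

End WeightsOfRepresentations.

Theorem corollary1p2 (R : realType) (V W : vectType R[i])
    (rho : u1rep V) (sigma : u1rep W) :
  self_dual rho -> faithful rho ->
  self_dual sigma -> faithful sigma ->
  (forall n : nat, (0 < n)%N ->
    \dim (invariants (tensor_rep n rho)) =
    \dim (invariants (tensor_rep n sigma))) ->
  rep_iso rho sigma.
Proof.
move=> rho_sd rho_f sigma_sd sigma_f dims.
have [k kw] := ex_weights rho; have [l lw] := ex_weights sigma.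
have counts n : (0 < n)%N -> zero_sum_count k n = zero_sum_count l n.
  by move=> /dims; rewrite (dim_tensor_invariants n kw) (dim_tensor_invariants n lw).
have [g gbij lg] := perm_codom_bij (zero_sum_count_perm
  (self_dual_weights kw rho_sd) (self_dual_weights lw sigma_sd)
  (faithful_weights kw rho_f) (faithful_weights lw sigma_f) counts).
exact: rep_iso_weights gbij lg kw lw.
Qed.
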